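(* For all positive natural numbers $k,r$ and every $r$-edge coloring $c:[\mathbb{N}]^2\to\{0,\dots,r-1\}$ of the complete graph $K_{\mathbb{N}}$ on $\mathbb{N}$, the vertex set $\mathbb{N}$ can be partitioned into a finite set and at most $r^{(k-1)r+1}$ one-way infinite monochromatic $k^{th}$ powers of paths.
   Context: A one-way infinite $k^{th}$ power of a path is a sequence $v_0,v_1,\dots$ of distinct vertices such that $\{v_i,v_j\}$ is an edge whenever $1\le |i-j|\le k$ (equivalently, the $k^{th}$ graph power of the path $v_0v_1\dots$, where $u,w$ are adjacent iff there is a path of length at most $k$ between them in the original path, is contained in the graph). It is monochromatic (of color $i$) if all these edges $\{v_i,v_j\}$ with $1\le|i-j|\le k$ have color $i$. *)

(* Defs.v *)
From mathcomp Require Import all_boot all_algebra.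
From mathcomp Require Import classical_sets cardinality.

Set Implicit Arguments.
Unset Strict Implicit.
Unset Printing Implicit Defensive.

(* A coloring of the two-element subsets of V is a binary function that does
   not depend on the order of two distinct arguments; its values on the diagonal
   are irrelevant. *)
Definition edge_coloring (V C : Type) (c : V -> V -> C) : Prop :=
  forall x y : V, x <> y -> c x y = c y x.

Definition complete_graph (V : Type) : V -> V -> Prop := fun x y => x <> y.

Definition infinite_path_power (V : Type) (E : V -> V -> Prop) (k : nat)
    (v : nat -> V) : Prop :=
  injective v /\
  forall i j : nat, (1 <= `|i - j| <= k)%N -> E (v i) (v j).

Definition monochromatic_path_power (V C : Type) (c : V -> V -> C) (k : nat)
    (v : nat -> V) : Prop :=
  infinite_path_power (@complete_graph V) k v /\
  exists col : C,
    forall i j : nat, (1 <= `|i - j| <= k)%N -> c (v i) (v j) = col.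

Local Open Scope classical_set_scope.

(* The family P lists the infinite parts without repetition: ranges of distinct
   indices are disjoint (and never empty). The finite part F may be empty. *)
Definition partition_finite_and_sequences (V : Type) (F : set V) (m : nat)
    (P : 'I_m -> nat -> V) : Prop :=
  [/\ finite_set F,
      trivIset [set: 'I_m] (fun i => range (P i)),
      F `&` \bigcup_i range (P i) = set0 &
      F `|` \bigcup_i range (P i) = [set: V]].

(* Main.v *)
Require Import Defs.
From mathcomp Require Import all_boot all_algebra.
From mathcomp Require Import classical_sets cardinality.
From mathcomp Require Import boolp filter zify.

(* Given an infinite set A and a nonprincipal ultrafilter U containing A, every
   vertex v sees U-almost all vertices in a single color, and this splits A into
   r classes. Splitting every infinite class again, with a new ultrafilter
   containing it, gives after d = (k-1)r+1 rounds at most r^d infinite classes,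
   up to a finite set. The d colors recorded along the way for a class A contain
   some color i at least k times, which yields sets
   A = B_0 <= B_1 <= ... <= B_k and ultrafilters U_1, ..., U_k, with B_j in U_j,
   such that every vertex of B_(j-1) is joined in color i to U_j-almost all
   vertices. Hence finitely many vertices of B_0, ..., B_(j-1) always have
   infinitely many common i-neighbors in B_j.

   A path with level sequence k, ..., 1, 0, k, ..., 1, 0, ... is built from
   blocks, the vertices of each block being chosen from level 0 up to level k,
   each joined in color i to all vertices of smaller level chosen before it. Two
   vertices at distance at most k are then adjacent in color i: inside a block
   the later one was chosen first and has the smaller level, and across two
   consecutive blocks the earlier one has the smaller level. The paths of all
   infinite classes are built in turns, avoiding all vertices used before. *)

Set Implicit Arguments.
Unset Strict Implicit.
Unset Printing Implicit Defensive.

Local Open Scope classical_set_scope.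

(** * Nonprincipal ultrafilters *)

Definition nonprincipal (T : Type) (U : set_system T) : Prop :=
  UltraFilter U /\ forall X : set T, finite_set X -> U (~` X).

(** Any ultrafilter refining the filter [G] of sets that miss only finitely many points of [A] will
    do; [G] is proper because [A] is infinite. *)
Lemma infinite_set_ultrafilter (T : Type) (A : set T) : infinite_set A ->
  exists2 U : set_system T, nonprincipal U & U A.
Proof.
move=> Ainf; pose G : set_system T := [set S | finite_set (A `\` S)].
have GF : ProperFilter G.
  split; first by rewrite /G /= setD0.
  split.
  - by rewrite /G /= setDT; exact: finite_set0.
  - by move=> S S' GS GS'; rewrite /G /= setDIr finite_setU.
  - move=> S S' SS' /sub_finite_set; apply => x [Ax nS'x].
    by split=> // /SS'.
have [U [UU GU]] := ultraFilterLemma GF.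
exists U; last by apply: GU; rewrite /G /= setDv; exact: finite_set0.
split=> // X Xfin; apply: GU; apply: sub_finite_set Xfin => x [_].
by rewrite /= /setC /= notK.
Qed.

Lemma ultrafilter_infinite (T : Type) (U : set_system T) (A : set T) :
  nonprincipal U -> U A -> infinite_set A.
Proof.
move=> [UU Unp] UA /Unp UnA.
by have [x []] := filter_ex (filterI UA UnA).
Qed.

Lemma ultrafilter_fiber (T : Type) (I : finType) (U : set_system T)
    (g : T -> I) : UltraFilter U -> exists i, U (g @^-1` [set i]).
Proof.
move=> UU; apply: contrapT => /forallNP nU.
have Unot : \forall x \near U, forall i, ~ g x = i.
  apply: filter_forall => i.
  by have [/nU|] := in_ultra_setVsetC (g @^-1` [set i]) UU.
by have [x /(_ (g x))] := filter_ex Unot.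
Qed.

Lemma infinite_set_notin (T : choiceType) (A : set T) (used : seq T) :
  infinite_set A -> exists2 y, A y & y \notin used.
Proof.
move=> /infinite_setD /(_ (finite_seq used)) /infinite_setN0 [y [Ay yu]].
by exists y => //; apply/negP.
Qed.

(** * Splitting into color classes *)

Section Colorings.
Variables (C : finType) (c : nat -> nat -> C).

(* The head of s is the color of the last splitting. *)
Fixpoint linked (s : seq C) (A : set nat) : Prop :=
  if s is i :: s' then
    exists (B : set nat) (U : set_system nat),
      [/\ A `<=` B, nonprincipal U, U B,
          forall v, A v -> U [set w | c v w = i] & linked s' B]
  else True.

Lemma linked_sub (s : seq C) (A B : set nat) :
  A `<=` B -> linked s B -> linked s A.
Proof.
case: s => //= i s AB [D [U [BD Unp UD Uc sD]]].
by exists D, U; split=> // [|v /AB]; [exact: subset_trans BD | exact: Uc].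
Qed.

Lemma linked_partition (d : nat) :
  exists f : nat -> d.-tuple C, forall s : d.-tuple C,
    finite_set (f @^-1` [set s]) \/ linked s (f @^-1` [set s]).
Proof.
elim: d => [|d [f fP]].
  by exists (fun=> [tuple]) => s; right; rewrite (tuple0 s).
have /choice[g gP] (s : d.-tuple C) : exists g : nat -> C,
    finite_set (f @^-1` [set s]) \/
    forall i, linked (i :: s) (f @^-1` [set s] `&` g @^-1` [set i]).
  (* On a finite class any splitting will do, and [c 0] is a placeholder. *)
  have [fin|lnk] := fP s; first by exists (c 0); left.
  have [fin|/infinite_set_ultrafilter[U Unp UA]] :=
    pselect (finite_set (f @^-1` [set s])); first by exists (c 0); left.
  have /choice[g gP] v : exists i, U (c v @^-1` [set i]).
    by apply: ultrafilter_fiber; case: Unp.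
  exists g; right => i; exists (f @^-1` [set s]), U; split=> //.
  by move=> v [_ <-]; exact: gP.
exists (fun v => [tuple of g (f v) v :: f v]) => s.
have sE : s = [tuple of thead s :: [tuple of behead s]] by exact: tuple_eta.
have sub : (fun v => [tuple of g (f v) v :: f v]) @^-1` [set s] `<=`
    f @^-1` [set [tuple of behead s]] `&`
    g [tuple of behead s] @^-1` [set thead s].
  move=> v /= vs; have fv : f v = [tuple of behead s].
    by apply/val_inj; rewrite /= -vs.
  by split=> //=; rewrite -fv -vs theadE.
have [fin|lnk] := gP [tuple of behead s].
  by left; apply: sub_finite_set fin => v /sub[].
right; rewrite {1}sE; apply: linked_sub sub _; exact: lnk.
Qed.

(** Avoiding an arbitrary finite list [used] encodes that there are infinitely many common
    neighbors. *)
Definition reservoirs (k : nat) (i : C) (B : nat -> set nat) : Prop :=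
  forall j, j <= k -> forall used F : seq nat,
    (forall f, f \in F -> exists2 j', j' < j & B j' f) ->
    exists y, [/\ B j y, y \notin used & forall f, f \in F -> c f y = i].

Lemma linked_reservoirs (i : C) (s : seq C) (k : nat) (A : set nat) :
  k <= count_mem i s -> linked s A -> infinite_set A ->
  exists2 B, B 0 = A & reservoirs k i B.
Proof.
elim: s k A => [|a s IHs] [|k] A //= ks lnk Ainf.
(* In both cases [k = 0]: nothing lies below level 0, so [F] is empty. *)
1,2: exists (fun=> A) => // -[] // _ used [|f F] FP;
  [have [y Ay yu] := infinite_set_notin used Ainf; exists y
  |have [] := FP f (mem_head f F)]; by [].
case: lnk => D [U [AD Unp UD Uc sD]].
move: ks; have [ai|ai] := eqVneq a i; last first.
  by rewrite add0n => ks; apply: IHs => //; exact: linked_sub sD.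
rewrite add1n ltnS => ks.
have [B B0 BP] := IHs _ _ ks sD (ultrafilter_infinite Unp UD).
(* This occurrence of [i] puts [A] as a new lowest level under those built from [D]. *)
exists (fun j => if j is j'.+1 then B j' else A) => //.
case=> [_|j jk] used F FP.
  have [y Ay yu] := infinite_set_notin used Ainf; exists y.
  by split=> // f /FP[].
(* From level 2 on, vertices of [A] count as vertices of [D] and the induction hypothesis applies.
   Only level 1, which is [D] itself, needs [U]. *)
case: j => [|j] in jk FP *; last first.
  apply: BP => // f /FP[[|j'] j'j fB]; last by exists j'.
  by exists 0 => //; rewrite B0; exact: AD.
have {}FP f : f \in F -> A f by move=> /FP[[]].
have UF : U [set y | forall f, f \in F -> c f y = i].
  have [UU _] := Unp; elim: F FP {BP} => [|f F IHF] FP.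
    by apply: filterE.
  have UF := IHF (fun f' f'F => FP f' (mem_behead (s := f :: F) f'F)).
  have Uf := Uc f (FP f (mem_head f F)).
  apply: filterS (filterI Uf UF) => y [fy Fy] f'.
  by rewrite inE => /predU1P[->|/Fy//]; rewrite fy.
have [UU _] := Unp.
have := infinite_set_notin used (ultrafilter_infinite Unp (filterI UD UF)).
by move=> [y [Dy Fy] yu]; exists y; split=> //; rewrite B0.
Qed.

End Colorings.

(** * Building all paths in one sequence of choices *)

Lemma dependent_sequence (T : Type) (Q : seq T -> T -> Prop) :
  (forall h, exists y, Q h y) ->
  exists x : nat -> T, forall n, Q (mkseq x n) (x n).
Proof.
move=> /choice[g gP].
pose h n := iter n (fun h => rcons h (g h)) [::].
exists (g \o h) => n; suff -> : mkseq (g \o h) n = h n by exact: gP.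
by elim: n => // n IHn; rewrite mkseqS IHn.
Qed.

Lemma interleave (C : finType) (c : nat -> nat -> C) (k m : nat)
    (col : 'I_m -> C) (B : 'I_m -> nat -> set nat) :
  edge_coloring c -> (forall a, reservoirs c k (col a) (B a)) ->
  exists P : 'I_m -> nat -> nat,
    [/\ forall a b p q, P a p = P b q -> a = b /\ p = q,
        forall a v, B a 0 v -> exists b p, P b p = v &
        forall a p q, p < q <= p + k -> c (P a p) (P a q) = col a].
Proof.
case: m => [|m] in col B * => c_col BP.
  by exists (fun _ n => n); split=> -[].
(* The stage [t] is read in mixed radix: level, then path, then round. *)
pose rank t := t %% k.+1.
pose idx t : 'I_m.+1 := inord ((t %/ k.+1) %% m.+1).
pose round t := t %/ k.+1 %/ m.+1.
(* The last clause makes the paths exhaust every B a 0: in round n, path a takes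
   the vertex n at level 0 whenever it is available. *)
pose Q (h : seq nat) (y : nat) := let T := size h in
  [/\ B (idx T) (rank T) y, y \notin h,
      forall t, t < T -> idx t = idx T -> rank t < rank T ->
        B (idx t) (rank t) (nth 0 h t) -> c (nth 0 h t) y = col (idx T) &
      rank T = 0 -> B (idx T) 0 (round T) -> round T \notin h -> y = round T].
have /dependent_sequence[x xP] h : exists y, Q h y.
  pose T := size h.
  (* At level 0 no color condition is imposed, so a demanded vertex can be taken at once. *)
  have [[T0 BT Th]|nT] :=
    pselect [/\ rank T = 0, B (idx T) 0 (round T) & round T \notin h].
    by exists (round T); split; rewrite -/T ?T0.
  (* The history [h] is arbitrary here, so membership in the levels must be tested; [xB] shows that
     the sequence obtained always passes the test. *)
  pose F := [seq nth 0 h t | t <- iota 0 T &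
    [&& idx t == idx T, rank t < rank T &
        `[< B (idx t) (rank t) (nth 0 h t) >]]].
  have rT : rank T <= k by rewrite -ltnS ltn_mod.
  have [f /mapP[t]|y [yB yh yF]] := BP (idx T) (rank T) rT h F.
    rewrite mem_filter => /andP[/and3P[/eqP <- tT /asboolP tB] _ ->].
    by exists (rank t).
  exists y; split=> // [t tT ti tr tB|T0 BT Th]; last by case: nT.
  apply: yF; apply/mapP; exists t => //.
  rewrite mem_filter mem_iota tT ti eqxx tr -ti.
  by apply/andP; split=> //; apply/asboolP.
have xB t : B (idx t) (rank t) (x t) by have [] := xP t; rewrite size_mkseq.
have x_new t t' : t < t' -> x t != x t'.
  move=> tt'; have [_ + _ _] := xP t'; apply: contraNneq => <-.
  by apply/mapP; exists t; rewrite ?mem_iota.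
have x_inj : injective x.
  by move=> t t' xtt'; case: (ltngtP t t') => // /x_new; rewrite xtt' eqxx.
have x_col t t' : t < t' -> idx t = idx t' -> rank t < rank t' ->
    c (x t) (x t') = col (idx t').
  move=> tt' it rt; have [_ _ + _] := xP t'; rewrite size_mkseq.
  by move=> /(_ t tt' it rt); rewrite nth_mkseq //; apply.
(* The stage that chooses position [p] of path [a]; positions within a block are filled from last to
   first. *)
pose time (a : 'I_m.+1) p := (p %/ k.+1 * m.+1 + a) * k.+1 + (k - p %% k.+1).
have rank_lt p : k - p %% k.+1 < k.+1 by rewrite ltnS leq_subr.
have time_div a p : time a p %/ k.+1 = p %/ k.+1 * m.+1 + a.
  by rewrite /time divnMDl // (divn_small (rank_lt p)) addn0.
have rank_time a p : rank (time a p) = k - p %% k.+1.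
  by rewrite /rank /time modnMDl modn_small.
have idx_time a p : idx (time a p) = a.
  by rewrite /idx time_div modnMDl modn_small // inord_val.
have round_time a p : round (time a p) = p %/ k.+1.
  by rewrite /round time_div divnMDl // (divn_small (ltn_ord a)) addn0.
have time_surj t : time (idx t) (round t * k.+1 + (k - rank t)) = t.
  have rt : rank t <= k by rewrite -ltnS ltn_mod.
  rewrite /time divnMDl // modnMDl (divn_small (m := k - _)) ?ltnS ?leq_subr //.
  rewrite modn_small ?ltnS ?leq_subr // subKn // addn0.
  by rewrite /idx inordK ?ltn_mod // -divn_eq -divn_eq.
have x_hit t : B (idx t) 0 (round t) -> rank t = 0 -> exists t', x t' = round t.
  move=> tB t0; have [_ _ _] := xP t; rewrite size_mkseq => /(_ t0 tB).
  have [/mapP[t' _ ->] _|_ <-//] := boolP (round t \in _); last by exists t.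
  by exists t'.
exists (fun a p => x (time a p)); split.
- move=> a b p q /x_inj tt'; split.
    by rewrite -(idx_time a p) tt' idx_time.
  have pk : p %% k.+1 <= k by rewrite -ltnS ltn_mod.
  have qk : q %% k.+1 <= k by rewrite -ltnS ltn_mod.
  have := rank_time a p; have := round_time a p.
  rewrite tt' round_time rank_time => pq_div pq_mod.
  by rewrite (divn_eq p k.+1) (divn_eq q k.+1) pq_div; congr addn; lia.
(* Position [v * k.+1 + k] is chosen at level 0 in round [v], when [v] is demanded. *)
- move=> a v av; have [||t xt] := x_hit (time a (v * k.+1 + k)).
  + by rewrite idx_time round_time divnMDl // divn_small // addn0.
  + by rewrite rank_time modnMDl modn_small // subnn.
  exists (idx t), (round t * k.+1 + (k - rank t)); rewrite time_surj xt.
  by rewrite round_time divnMDl // divn_small // addn0.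
- move=> a p q /andP[pq qpk].
  have pk : p %% k.+1 < k.+1 by rewrite ltn_mod.
  have qk : q %% k.+1 < k.+1 by rewrite ltn_mod.
  have pE := divn_eq p k.+1; have qE := divn_eq q k.+1.
  have ak : a < m.+1 by [].
  have [same|next] : p %/ k.+1 = q %/ k.+1 \/ q %/ k.+1 = (p %/ k.+1).+1.
    have : p %/ k.+1 <= q %/ k.+1 by apply: leq_div2r; exact: ltnW.
    have : q %/ k.+1 <= (p + k.+1) %/ k.+1 by apply: leq_div2r; lia.
    by rewrite divnDr // divnn /=; lia.
  + have qp_time : time a q < time a p by rewrite /time same; lia.
    have qp : x (time a p) <> x (time a q).
      by apply/eqP; rewrite eq_sym x_new.
    by rewrite c_col // x_col ?idx_time ?rank_time //; lia.
  (* Across blocks, [q <= p + k] forces [q %% k.+1 < p %% k.+1], so [p] has the smaller level. *)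
  + have pq_time : time a p < time a q by rewrite /time next; nia.
    by rewrite x_col ?idx_time ?rank_time //; lia.
Qed.

(** * Counting colors and assembling the partition *)

Lemma count_mem_pigeonhole (C : finType) (k : nat) (s : seq C) :
  0 < k -> k.-1 * #|C| < size s -> exists i, k <= count_mem i s.
Proof.
move=> k0 ks; apply: contrapT => /forallNP small.
have sizeE : size s = \sum_(i : C) count_mem i s.
  elim: s {ks small} => [|a s IHs] /=; first by rewrite big1.
  rewrite big_split /= -IHs (bigD1 a) //= eqxx big1 // => i /negPf.
  by rewrite eq_sym => ->.
move: ks; rewrite sizeE ltnNge => /negP; apply.
rewrite mulnC -sum_nat_const; apply: leq_sum => i _.
by have /negP := small i; lia.
Qed.

Theorem theorem4p6 (k r : nat) (k_gt0 : 0 < k) (r_gt0 : 0 < r)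
    (c : nat -> nat -> 'I_r) (c_col : edge_coloring c) :
  exists (m : nat) (F : set nat) (P : 'I_m -> nat -> nat),
    [/\ m <= r ^ (k.-1 * r + 1),
        partition_finite_and_sequences F P &
        forall i : 'I_m, monochromatic_path_power c k (P i)].
Proof.
set d := k.-1 * r + 1.
have [f fP] := linked_partition c d.
pose L := [pred s : d.-tuple 'I_r | ~~ `[< finite_set (f @^-1` [set s]) >]].
have /choice[B] (a : 'I_#|L|) : exists B : nat -> set nat,
    B 0 = f @^-1` [set enum_val a] /\ exists i, reservoirs c k i B.
  have /asboolPn inf := enum_valP a.
  have [//|lnk] := fP (enum_val a).
  have [|i ki] := @count_mem_pigeonhole _ k (enum_val a) k_gt0.
    by rewrite size_tuple card_ord /d addn1.
  have [B B0 BP] := linked_reservoirs ki lnk inf.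
  by exists B; split=> //; exists i.
move=> /all_and2[B0 /choice[col BP]].
have [P [P_inj P_cover P_col]] := interleave c_col BP.
pose R := \bigcup_(a in [set: 'I_#|L|]) range (P a).
exists #|L|, (~` R), P; split.
- by rewrite (leq_trans (max_card _)) // card_tuple card_ord.
- split.
  (* The paths cover every infinite class, so what is left lies in the finite classes, of which
     there are finitely many. *)
  + have fin : finite_set (\bigcup_(s in [set s | finite_set (f @^-1` [set s])])
          f @^-1` [set s]).
      by apply: bigcup_finite => //; exact: finite_finset.
    apply: sub_finite_set fin => v Rv; exists (f v) => //=.
    apply: contrapT => inf; apply: Rv.
    have fL : f v \in L by apply/asboolPn.
    have [|b [p <-]] := P_cover (enum_rank_in fL (f v)) v.
      by rewrite B0 enum_rankK_in.
    by exists b => //; exists p.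
  + by move=> a b _ _ [v [[p _ <-] [q _ /P_inj[]]]].
  + by rewrite setICl.
  + by rewrite setUCl.
- move=> a; have Pa_inj : injective (P a) by move=> p q /P_inj[].
  have dist (p q : nat) :
      1 <= `|p - q| <= k -> p < q <= p + k \/ q < p <= q + k.
    by lia.
  split; first split=> //.
    by move=> p q /dist pq /Pa_inj; lia.
  exists (col a) => p q /dist[/P_col//|qp].
  by rewrite c_col ?P_col // => /Pa_inj; lia.
Qed.
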